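(* Let $\mathcal I=(i_-,i_+)\subseteq\mathbb R$ and let $P,Q$ be smooth functions on $\mathcal I$ with $P\ge 0$. Assume $Q$ is strictly increasing on $\mathcal I$ with $Q'(x)>0$ for all $x\in\mathcal I$, and $$\lim_{x\to i_-}Q(x)<0,\qquad \lim_{x\to i_+}Q(x)>0 .$$ Let $f_\infty$ be a probability density on $\mathcal I$ satisfying $$\frac{d}{dx}\big(P(x)f_\infty(x)\big)+Q(x)f_\infty(x)=0,\qquad x\in\mathcal I,$$ and let $X$ be a random variable with density $f_\infty$. Define $w(x)=P(x)/Q'(x)$ for $x\in\mathcal I$. Then for every smooth function $\phi$ on $\mathcal I$ such that $\phi(X)$ has finite variance, $$\int_{\mathcal I}\phi^2 f_\infty\,dx-\Big(\int_{\mathcal I}\phi f_\infty\,dx\Big)^2\le \int_{\mathcal I} w(x)\,(\phi'(x))^2 f_\infty(x)\,dx,$$ i.e. $\mathrm{Var}[\phi(X)]\le E\{w(X)[\phi'(X)]^2\}$ (meaning: whenever the right-hand side is finite, the inequality holds).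
   Context: $\mathrm{Var}[\phi(X)]=E[\phi(X)^2]-(E[\phi(X)])^2$. The differential relation for $f_\infty$ expresses that $f_\infty$ is a stationary solution of the Fokker–Planck equation $\partial_t f=\partial_x^2(Pf)+\partial_x(Qf)$ on $\mathcal I$. *)

(* Defs.v *)
From HB Require Import structures.
From mathcomp Require Import all_boot all_order all_algebra.
From mathcomp Require Import all_classical all_reals all_analysis.
Set Implicit Arguments. Unset Strict Implicit. Unset Printing Implicit Defensive.
Import Order.TTheory GRing.Theory Num.Theory.
Import numFieldNormedType.Exports.
Local Open Scope classical_set_scope.
Local Open Scope ring_scope.

Definition open_itv (R : realType) (a b : \bar R) : set R :=
  [set x : R | (a < x%:E)%E /\ (x%:E < b)%E].

Definition lower_end (R : realType) (a : \bar R) : set_system R :=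
  match a with EFin r => r^'+ | _ => ninfty_nbhs R end.

Definition upper_end (R : realType) (b : \bar R) : set_system R :=
  match b with EFin r => r^'- | _ => pinfty_nbhs R end.

Definition smooth_on (R : realType) (I : set R) (f : R -> R) : Prop :=
  forall (n : nat) (x : R), I x -> derivable (derive1n n f) x 1.

(* Main.v *)
Require Import Defs.
From mathcomp Require Import all_boot all_order all_algebra.
From mathcomp Require Import all_classical all_reals all_analysis.
From mathcomp Require Import measurable_realfun ring lra.
Set Implicit Arguments.
Unset Strict Implicit.
Unset Printing Implicit Defensive.
Import Order.TTheory GRing.Theory Num.Theory.
Import numFieldNormedType.Exports.
Local Open Scope classical_set_scope.
Local Open Scope ring_scope.

(** Let [m] be the zero of [Q], let [W] be a primitive of [phi'^2 / Q'], and put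
    [g = P f], so that [g' = - Q f]. The variance of [phi(X)] is at most the
    mean of [(phi - phi m)^2], and the Cauchy-Schwarz inequality on the segment
    from [m] to [x] gives [(phi - phi m)^2 <= Q (W - W m)]. An integration by
    parts yields
    [int Q f (W - W m) = - int g' (W - W m) <= int g W' = int w phi'^2 f],
    the boundary terms having the right sign since [W - W m] and [x - m] have
    the same sign. As [f] is merely measurable, this integration by parts rests
    on the inequality [int_x^y F' <= F y - F x], valid whenever [F' >= 0]. *)

Lemma fatou_cvg {d : measure_display} {T : measurableType d} {R : realType}
    (mu : {measure set T -> \bar R}) (D : set T) (u : (T -> \bar R)^nat)
    (f : T -> \bar R) (l : \bar R) : measurable D ->
  (forall n, measurable_fun D (u n)) -> (forall n x, D x -> (0 <= u n x)%E) ->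
  (forall x, D x -> u n x @[n --> \oo] --> f x) ->
  (\int[mu]_(x in D) u n x)%E @[n --> \oo] --> l ->
  (\int[mu]_(x in D) f x <= l)%E.
Proof.
move=> mD mu_u u_ge0 uf int_ul; rewrite -(cvg_limn_einf_sup int_ul).1.
rewrite (eq_integral (fun x => limn_einf (u^~ x))); first exact: fatou.
by move=> x /set_mem /uf /cvg_limn_einf_sup[].
Qed.

Section one_variable_calculus.
Context {R : realType}.
Local Notation mu := (@lebesgue_measure R).
Implicit Types (I : set R) (F f h : R -> R).

Lemma is_derive_continuous F (x dF : R) :
  is_derive x 1 F dF -> {for x, continuous F}.
Proof. by case=> dFx _; exact/differentiable_continuous/derivable1_diffP. Qed.

Lemma is_interval_subset_itvcc I (x y : R) :
  is_interval I -> I x -> I y -> `[x, y]%classic `<=` I.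
Proof. by move=> iI Ix Iy t; rewrite /= in_itv/=; exact: iI. Qed.

Lemma open_exists_lt I (x : R) : open I -> I x -> exists2 y, I y & y < x.
Proof.
move=> oI Ix; have near_I : \forall y \near x^'-, I y.
  by apply: cvg_within; exact: open_nbhs_nbhs.
have [y [Iy yx]] : exists y, I y /\ y < x; last by exists y.
by apply: (@filter_ex _ x^'-); apply: filterI near_I _; exact: nbhs_left_lt.
Qed.

Lemma open_exists_gt I (x : R) : open I -> I x -> exists2 y, I y & x < y.
Proof.
move=> oI Ix; have near_I : \forall y \near x^'+, I y.
  by apply: cvg_within; exact: open_nbhs_nbhs.
have [y [Iy xy]] : exists y, I y /\ x < y; last by exists y.
by apply: (@filter_ex _ x^'+); apply: filterI near_I _; exact: nbhs_right_gt.
Qed.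

Lemma continuous_integrable_itvcc f (a b : R) :
  (forall x, `[a, b]%classic x -> {for x, continuous f}) ->
  mu.-integrable `[a, b] (EFin \o f).
Proof.
move=> fC; apply: continuous_compact_integrable; first exact: segment_compact.
by apply: continuous_in_subspaceT => x /set_mem; exact: fC.
Qed.

Lemma integral_is_derive F f (a b : R) : a <= b ->
  (forall x, `[a, b]%classic x -> is_derive x 1 F (f x)) ->
  (forall x, `[a, b]%classic x -> {for x, continuous f}) ->
  (\int[mu]_(x in `[a, b]) (f x)%:E = (F b - F a)%:E)%E.
Proof.
rewrite le_eqVlt => /predU1P[<- _ _|ab dF fC].
  by rewrite set_itv1 integral_set1 subrr.
have FC x : `[a, b]%classic x -> {for x, continuous F}.
  by move=> /dF; exact: is_derive_continuous.
rewrite EFinB; apply: continuous_FTC2 => //.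
- by apply: continuous_in_subspaceT => x /set_mem; exact: fC.
- split.
  + by move=> x /subset_itv_oo_cc /dF[].
  + by apply: cvg_at_right_filter; apply: FC; rewrite /= in_itv/= lexx ltW.
  + by apply: cvg_at_left_filter; apply: FC; rewrite /= in_itv/= lexx ltW.
- by move=> x /subset_itv_oo_cc /dF dFx; rewrite derive1E derive_val.
Qed.

Lemma Rintegral_itvccB f (a b c : R) :
  mu.-integrable `[a, b] (EFin \o f) -> a <= c <= b ->
  \int[mu]_(t in `[a, b]) f t - \int[mu]_(t in `[a, c]) f t =
  \int[mu]_(t in `[c, b]) f t.
Proof.
move=> intf /andP[ac cb]; rewrite Rintegral_itvB ?bnd_simp//.
rewrite Rintegral_itv_obnd_cbnd//; apply: integrableS intf => //.
by apply: subset_itvScc; rewrite bnd_simp.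
Qed.

Lemma exists_primitive I f : open I -> is_interval I ->
  (forall x, I x -> {for x, continuous f}) ->
  exists F, forall x, I x -> is_derive x 1 F (f x).
Proof.
move=> oI iI fC.
have [[m Im]|I0] := pselect (I !=set0); last first.
  by exists f => x Ix; case: I0; exists x.
have intf a b : I a -> I b -> mu.-integrable `[a, b] (EFin \o f).
  move=> Ia Ib; apply: continuous_integrable_itvcc => x.
  by move=> /(is_interval_subset_itvcc iI Ia Ib); exact: fC.
pose F t := \int[mu]_(s in `[Num.min m t, t]) f s
          - \int[mu]_(s in `[Num.min m t, m]) f s.
have FE a t : I a -> I t -> a <= m -> a <= t ->
    F t = \int[mu]_(s in `[a, t]) f s - \int[mu]_(s in `[a, m]) f s.
  move=> Ia It a_le_m a_le_t.
  pose c := Num.min m t; have a_le_c : a <= c by rewrite le_min a_le_m.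
  have cB z : I z -> c <= z -> \int[mu]_(s in `[c, z]) f s =
      \int[mu]_(s in `[a, z]) f s - \int[mu]_(s in `[a, c]) f s.
    by move=> Iz cz; rewrite (Rintegral_itvccB (intf a z Ia Iz)) ?a_le_c.
  by rewrite /F !cB// ?ge_min ?lexx ?orbT//; ring.
exists F => x Ix.
have [a Ia amx] : exists2 a, I a & a < Num.min m x.
  by apply: open_exists_lt => //; rewrite minElt; case: ifP.
have [b Ib xb] := open_exists_gt oI Ix.
move: amx; rewrite lt_min => /andP[am ax].
pose G t := \int[mu]_(s in `[a, t]) f s.
have dG : is_derive x 1 G (f x).
  have [GD <-] := continuous_FTC1_closed xb (intf a b Ia Ib) ax (fC x Ix).
  by rewrite derive1E; exact: derivableP.
apply: (@near_eq_is_derive _ _ _ (fun t => G t - G m)); last first.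
  by apply: is_derive_eq; rewrite subr0.
near=> t; rewrite (FE a)// ?(ltW am)//.
- by near: t; exact: open_nbhs_nbhs.
- by apply/ltW; near: t; exact: lt_nbhsr.
Unshelve. all: by end_near.
Qed.

Definition difference_quotient F (h x : R) := (F (x + h) - F x) / h.

Lemma cvg_difference_quotient F (x dF : R) (h : R^nat) :
  is_derive x 1 F dF -> (forall n, h n != 0) -> h n @[n --> \oo] --> 0 ->
  difference_quotient F (h n) x @[n --> \oo] --> dF.
Proof.
move=> [dFx dFE] h_neq0 h_to0.
have quot : (fun t => t^-1 *: (F (t *: 1 + x) - F x)) t @[t --> 0^'] --> dF.
  by rewrite -dFE; exact: dFx.
have /cvgr_dnbhsP/(_ h (conj h_neq0 h_to0)) := quot.
apply: cvg_trans; apply: near_eq_cvg; apply: nearW => n /=.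
by rewrite /difference_quotient [RHS]mulrC (addrC x) [(h n)%:A]mulr1.
Qed.

Lemma continuous_difference_quotient F (h x : R) :
  {for x, continuous F} -> {for x + h, continuous F} ->
  {for x, continuous (difference_quotient F h)}.
Proof.
move=> Fx Fxh; apply: cvgM; last exact: cvg_cst.
apply: cvgB => //; apply: continuous_comp => //.
by apply: cvgD => //; exact: cvg_cst.
Qed.

Lemma is_derive_difference_quotient F f (h x : R) :
  is_derive x 1 F (f x) -> is_derive (x + h) 1 F (f (x + h)) ->
  is_derive x 1 (difference_quotient F h) (difference_quotient f h x).
Proof.
move=> dFx dFxh.
have dFh : is_derive x 1 (F \o shift h) (f (x + h) * 1).
  by apply: is_derive1_comp; exact: is_derive_shift.
have -> : difference_quotient F h = h^-1 *: ((F \o shift h) - F).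
  by apply/funext => t; rewrite /difference_quotient mulrC.
by apply: is_derive_eq; rewrite mulr1 /difference_quotient mulrC.
Qed.

Lemma ge0_is_derive_nondecreasing I F f : is_interval I ->
  (forall x, I x -> is_derive x 1 F (f x)) -> (forall x, I x -> 0 <= f x) ->
  forall x y, I x -> I y -> x <= y -> F x <= F y.
Proof.
move=> iI dF f_ge0 x y Ix Iy xy.
have sub := is_interval_subset_itvcc iI Ix Iy.
apply: (@ger0_derive1_le_cc _ F x y) => //; rewrite ?in_itv/= ?lexx ?xy//.
- by move=> t /subset_itv_oo_cc /sub /dF[].
- move=> t /subset_itv_oo_cc /sub It; have dFt := dF t It.
  by rewrite derive1E derive_val f_ge0.
- apply: continuous_in_subspaceT => t /set_mem /sub /dF.
  exact: is_derive_continuous.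
Qed.

Lemma integral_difference_quotient H F (a b h : R) : a <= b ->
  (forall x, `[a, b]%classic x ->
    is_derive x 1 H (F x) /\ is_derive (x + h) 1 H (F (x + h))) ->
  (forall x, `[a, b]%classic x ->
    {for x, continuous F} /\ {for x + h, continuous F}) ->
  (\int[mu]_(x in `[a, b]) (difference_quotient F h x)%:E =
   (difference_quotient H h b - difference_quotient H h a)%:E)%E.
Proof.
move=> ab dH FC; apply: integral_is_derive => // x abx.
- by have [dHx dHxh] := dH x abx; exact: is_derive_difference_quotient.
- by have [Fx Fxh] := FC x abx; exact: continuous_difference_quotient.
Qed.

Lemma exists_vanishing_shifts I (a b : R) : open I -> is_interval I ->
  I a -> I b ->
  exists h : R^nat, [/\ forall n, 0 < h n, h n @[n --> \oo] --> 0 &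
    forall n x, `[a, b]%classic x -> I (x + h n)].
Proof.
move=> oI iI Ia Ib; have [c Ic bc] := open_exists_gt oI Ib.
pose h n := (c - b) * harmonic n.
have h_gt0 n : 0 < h n by rewrite mulr_gt0 ?subr_gt0// invr_gt0.
exists h; split => //.
- rewrite -(mulr0 (c - b)).
  by apply: cvgM; [exact: cvg_cst|exact: cvg_harmonic].
- move=> n x; rewrite /= in_itv/= => /andP[ax xb].
  apply: (iI a c) => //; rewrite (le_trans ax) ?lerDl ?(ltW (h_gt0 n))//=.
  rewrite -(subrK b c) addrC lerD// ler_piMr ?subr_ge0 ?(ltW bc)//.
  by rewrite invf_le1// ler1n.
Qed.

(* [f] need not be continuous, so the fundamental theorem of calculus does not
   apply to [F]; but the difference quotients of [F] are continuous, and they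
   are integrated exactly by means of a primitive of [F]. *)
Lemma ge0_integral_is_derive_le I F f (a b : R) : open I -> is_interval I ->
  (forall x, I x -> is_derive x 1 F (f x)) -> (forall x, I x -> 0 <= f x) ->
  I a -> I b -> a <= b ->
  (\int[mu]_(x in `[a, b]) (f x)%:E <= (F b - F a)%:E)%E.
Proof.
move=> oI iI dF f_ge0 Ia Ib ab.
have sub := is_interval_subset_itvcc iI Ia Ib.
have FC x : I x -> {for x, continuous F}.
  by move/dF; exact: is_derive_continuous.
have [H dH] := exists_primitive oI iI FC.
have [h [h_gt0 h_to0 Ih]] := exists_vanishing_shifts oI iI Ia Ib.
have h_neq0 n : h n != 0 by rewrite gt_eqF.
pose q n := difference_quotient F (h n).
have q_ge0 n x : `[a, b]%classic x -> 0 <= q n x.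
  move=> abx; rewrite divr_ge0 ?(ltW (h_gt0 n))// subr_ge0.
  apply: (ge0_is_derive_nondecreasing iI dF f_ge0); [exact: sub|exact: Ih|].
  by rewrite lerDl ltW.
have qC n x : `[a, b]%classic x -> {for x, continuous (q n)}.
  by move=> abx; apply: continuous_difference_quotient;
    apply: FC; [exact: sub|exact: Ih].
have cvg_intq :
    (\int[mu]_(x in `[a, b]) (q n x)%:E)%E @[n --> \oo] --> (F b - F a)%:E.
  have intq n : (\int[mu]_(x in `[a, b]) (q n x)%:E =
      (difference_quotient H (h n) b - difference_quotient H (h n) a)%:E)%E.
    apply: integral_difference_quotient => // x abx.
      by split; apply: dH; [exact: sub|exact: Ih].
    by split; apply: FC; [exact: sub|exact: Ih].
  under eq_cvg do rewrite intq.
  apply: cvg_EFin; first exact: nearW.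
  by apply: cvgB; apply: cvg_difference_quotient => //; exact: dH.
apply: fatou_cvg cvg_intq => //.
- by move=> n; have /integrableP[] := continuous_integrable_itvcc (@qC n).
- move=> x /sub Ix; apply: cvg_EFin; first exact: nearW.
  by apply: cvg_difference_quotient => //; exact: dF.
Qed.

Lemma quadratic_ge0_discriminant (a b c : R) :
  (forall t, 0 <= a - 2 * t * b + t ^+ 2 * c) -> b ^+ 2 <= a * c.
Proof.
move=> quad_ge0; pose p := Poly [:: a; - (2 * b); c].
have p_ge0 t : 0 <= p.[t].
  by have := quad_ge0 t; rewrite horner_Poly /= => /le_trans; apply; lra.
have size_p : (size p <= 3)%N by exact: size_Poly.
by have := deg_le2_poly_ge0 size_p p_ge0; rewrite !coef_Poly/=; lra.
Qed.

Lemma is_derive_cauchy_schwarz I (u v w u' v' w' : R -> R) : is_interval I ->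
  (forall x, I x -> is_derive x 1 u (u' x)) ->
  (forall x, I x -> is_derive x 1 v (v' x)) ->
  (forall x, I x -> is_derive x 1 w (w' x)) ->
  (forall x, I x -> 0 < v' x) ->
  (forall x, I x -> u' x ^+ 2 <= w' x * v' x) ->
  forall x y, I x -> I y ->
    (u y - u x) ^+ 2 <= (w y - w x) * (v y - v x).
Proof.
move=> iI du dv dw v'_gt0 u'w'v' x y Ix Iy.
wlog xy : x y Ix Iy / x <= y.
  move=> le_case; have [|/ltW yx] := leP x y; first exact: le_case.
  by rewrite -sqrrN -mulrNN !opprB; exact: le_case.
apply: quadratic_ge0_discriminant => c.
pose z t := w t - 2 * c * u t + c ^+ 2 * v t.
have dz t : I t -> is_derive t 1 z (w' t - 2 * c * u' t + c ^+ 2 * v' t).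
  move=> It; have [dut dvt dwt] := And3 (du t It) (dv t It) (dw t It).
  by apply: is_derive_eq; rewrite /GRing.scale/=; ring.
have z'_ge0 t : I t -> 0 <= w' t - 2 * c * u' t + c ^+ 2 * v' t.
  move=> It; rewrite -(pmulr_lge0 _ (v'_gt0 t It)).
  by have := u'w'v' t It; have := sqr_ge0 (u' t - c * v' t); nra.
by have := ge0_is_derive_nondecreasing iI dz z'_ge0 Ix Iy xy; rewrite /z; lra.
Qed.
End one_variable_calculus.

Section exhaustion.
Context {R : realType}.
Local Notation mu := (@lebesgue_measure R).
Implicit Type I : set R.

Lemma open_interval_coinitial_cofinal_seq I (m : R) :
  open I -> is_interval I -> I m ->
  exists e : R^nat, (forall n, I (e n)) /\
    forall x, I x -> (exists n, e n <= x) /\ (exists n, x <= e n).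
Proof.
move=> oI iI Im.
pose e n : R := if unpickle n is Some q
  then if `[< I (ratr q) >] then ratr q else m else m.
have eE (q : rat) : I (ratr q) -> e (pickle q) = ratr q.
  by move=> Iq; rewrite /e pickleK; case: ifPn => // /asboolP.
exists e; split=> [n|x Ix].
  by rewrite /e; case: unpickle => // q; case: ifPn => // /asboolP.
split.
- have [y Iy /rat_in_itvoo[q]] := open_exists_lt oI Ix.
  rewrite in_itv/= => /andP[yq /ltW qx]; exists (pickle q); rewrite eE//.
  by apply: (iI y x) => //; rewrite (ltW yq).
- have [y Iy /rat_in_itvoo[q]] := open_exists_gt oI Ix.
  rewrite in_itv/= => /andP[/ltW xq qy]; exists (pickle q); rewrite eE//.
  by apply: (iI x y) => //; rewrite xq ltW.
Qed.

Lemma open_interval_exhaustion I (m : R) : open I -> is_interval I -> I m ->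
  exists a b : R^nat,
    [/\ forall n, I (a n) /\ I (b n), forall n, a n <= m <= b n,
        {homo (fun n => `[a n, b n]%classic) : i j / (i <= j)%N >-> i `<=` j} &
        I = \bigcup_n `[a n, b n]%classic].
Proof.
move=> oI iI Im.
have [e [Ie ecof]] := open_interval_coinitial_cofinal_seq oI iI Im.
pose a n := \big[Num.min/m]_(i < n) e i.
pose b n := \big[Num.max/m]_(i < n) e i.
have Iab n : I (a n) /\ I (b n).
  split; first by apply: (big_ind I) => // x y Ix Iy; rewrite minElt; case: ifP.
  by apply: (big_ind I) => // x y Ix Iy; rewrite maxElt; case: ifP.
exists a, b; split => //.
- by move=> n; rewrite bigmin_le_id bigmax_ge_id.
- move=> i j ij; apply: subset_itvScc; rewrite bnd_simp.
    exact: (@le_bigmin_ord _ _ m j i xpredT e ij).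
  exact: (@le_bigmax_ord _ _ m i j xpredT e ij).
apply/seteqP; split => [x Ix|x [n _]]; last first.
  by have [Ia Ib] := Iab n; exact: is_interval_subset_itvcc.
have [[i eix] [j xej]] := ecof x Ix.
exists (maxn i.+1 j.+1) => //=; rewrite in_itv/=; apply/andP; split.
- apply: le_trans eix.
  have lt_i : (i < maxn i.+1 j.+1)%N by rewrite leq_max leqnn.
  exact: (bigmin_le m (Ordinal lt_i) (fun k => e k)).
- apply: (le_trans xej).
  have lt_j : (j < maxn i.+1 j.+1)%N by rewrite leq_max leqnn orbT.
  exact: (le_bigmax m (fun k : 'I_(maxn i.+1 j.+1) => e k) (Ordinal lt_j)).
Qed.

Lemma ge0_integral_le_segments I (m : R) (f : R -> \bar R) (c : \bar R) :
  open I -> is_interval I -> I m ->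
  measurable_fun I f -> (forall x, I x -> 0 <= f x)%E ->
  (forall x y, I x -> I y -> x <= m <= y ->
    (\int[mu]_(t in `[x, y]) f t <= c)%E) ->
  (\int[mu]_(t in I) f t <= c)%E.
Proof.
move=> oI iI Im mf f_ge0 le_c.
have [a [b [Iab amb abI IE]]] := open_interval_exhaustion oI iI Im.
have sub n : `[a n, b n]%classic `<=` I.
  by have [Ia Ib] := Iab n; exact: is_interval_subset_itvcc.
have mI : measurable I by exact: open_measurable.
have cvg_int : (\int[mu]_(t in `[a n, b n]) f t)%E @[n --> \oo] -->
    (\int[mu]_(t in I) f t)%E.
  rewrite [in X in _ --> X]IE.
  apply: (@ge0_nondecreasing_set_cvg_integral _ (measurableTypeR R) R
    (fun n => `[a n, b n]%classic)).
  - by move=> i j ij; apply/subsetPset; exact: abI.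
  - by move=> n; exact: measurable_itv.
  - by move=> n; exact: measurable_funS mf.
  - by move=> n x /sub; exact: f_ge0.
rewrite -(cvg_lim _ cvg_int)//; apply: lime_le.
  by apply/cvg_ex; eexists; exact: cvg_int.
by apply: nearW => n; have [Ia Ib] := Iab n; exact: le_c.
Qed.
End exhaustion.

Lemma variance_le_integral_sqrB {d : measure_display} {T : measurableType d}
    {R : realType} (mu : {measure set T -> \bar R}) (D : set T) (f phi : T -> R)
    (c : R) : measurable D -> measurable_fun D f -> measurable_fun D phi ->
  (forall x, D x -> 0 <= f x) -> (\int[mu]_(x in D) (f x)%:E = 1)%E ->
  mu.-integrable D (fun x => (phi x ^+ 2 * f x)%:E) ->
  (\int[mu]_(x in D) (phi x ^+ 2 * f x)%:E
   - (\int[mu]_(x in D) (phi x * f x)%:E) * (\int[mu]_(x in D) (phi x * f x)%:E)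
   <= \int[mu]_(x in D) ((phi x - c) ^+ 2 * f x)%:E)%E.
Proof.
move=> mD mf mphi f_ge0 f1 int_phi2.
have int_f : mu.-integrable D (EFin \o f).
  apply/integrableP; split; first exact/measurable_EFinP.
  rewrite (eq_integral (EFin \o f)) ?f1 ?ltry// => x /set_mem Dx /=.
  by rewrite ger0_norm// f_ge0.
have int_phi : mu.-integrable D (fun x => (phi x * f x)%:E).
  apply: (le_integrable mD _ _ (integrableD mD int_f int_phi2)) => /=.
    by apply/measurable_EFinP; exact: measurable_funM.
  move=> x /f_ge0 fx; rewrite lee_fin normrM (ger0_norm fx).
  have /ger0_norm -> : 0 <= f x + phi x ^+ 2 * f x.
    by rewrite addr_ge0// mulr_ge0// sqr_ge0.
  rewrite -{2}[f x]mul1r -mulrDl ler_wpM2r// -(real_normK (num_real (phi x))).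
  by have := sqr_ge0 (`|phi x| - 1); have := normr_ge0 (phi x); nra.
have -> : (\int[mu]_(x in D) ((phi x - c) ^+ 2 * f x)%:E =
    \int[mu]_(x in D) (phi x ^+ 2 * f x)%:E
    + ((- (2 * c))%:E * \int[mu]_(x in D) (phi x * f x)%:E
       + (c ^+ 2)%:E * \int[mu]_(x in D) (f x)%:E))%E.
  rewrite -integralZl// -[X in (_ + (_ + X))%E]integralZl//.
  have int_cphi := integrableZl mD (- (2 * c)) int_phi.
  have int_cf := integrableZl mD (c ^+ 2) int_f.
  rewrite -integralD// -integralD//; last exact: integrableD.
  by apply: eq_integral => x _; rewrite /= -!EFinM -!EFinD; congr EFin; ring.
have /fineK <- := integrable_fin_num mD int_phi2.
have /fineK <- := integrable_fin_num mD int_phi.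
rewrite f1 mule1 -!EFinM -EFinB -!EFinD lee_fin.
by have := sqr_ge0 (fine (\int[mu]_(x in D) (phi x * f x)%:E) - c); nra.
Qed.

Lemma continuous_on_open_measurable_fun {R : realType} (I : set R)
    (h : R -> R) :
  open I -> (forall x, I x -> {for x, continuous h}) -> measurable_fun I h.
Proof.
move=> oI hC; apply: open_continuous_measurable_fun => // x /set_mem.
exact: hC.
Qed.

Lemma is_derive_measurable_fun {R : realType} (I : set R) (h dh : R -> R) :
  open I -> (forall x, I x -> is_derive x 1 h (dh x)) -> measurable_fun I h.
Proof.
move=> oI dhP; apply: continuous_on_open_measurable_fun => // x /dhP.
exact: is_derive_continuous.
Qed.

Section stationary_density.
Context {R : realType}.
Local Notation mu := (@lebesgue_measure R).
Variables (I : set R) (m : R) (g f Q : R -> R).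
Hypotheses (oI : open I) (iI : is_interval I) (Im : I m).
Hypothesis dg : forall x, I x -> is_derive x 1 g (- (Q x * f x)).
Hypothesis g_ge0 : forall x, I x -> 0 <= g x.
Hypothesis f_ge0 : forall x, I x -> 0 <= f x.

Lemma integral_drift_primitive_le (W w : R -> R) x y :
  (forall t, I t -> is_derive t 1 W (w t)) ->
  (forall t, I t -> {for t, continuous w}) -> (forall t, I t -> 0 <= w t) ->
  (forall t, I t -> 0 <= Q t * (W t - W m)) ->
  I x -> I y -> x <= m <= y ->
  (\int[mu]_(t in `[x, y]) (Q t * (W t - W m) * f t)%:E <=
   \int[mu]_(t in `[x, y]) (g t * w t)%:E)%E.
Proof.
move=> dW wC w_ge0 QW_ge0 Ix Iy /andP[xm my]; have xy := le_trans xm my.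
have sub := is_interval_subset_itvcc iI Ix Iy.
have W_nondecr := ge0_is_derive_nondecreasing iI dW w_ge0.
have gwC t : I t -> {for t, continuous (fun z => g z * w z)}.
  by move=> It; apply: cvgM; [exact: is_derive_continuous (dg It)|exact: wC].
have [K dK] := exists_primitive oI iI gwC.
pose F t := K t - g t * (W t - W m).
have dF t : I t -> is_derive t 1 F (Q t * (W t - W m) * f t).
  move=> It; have [dgt dKt dWt] := And3 (dg It) (dK _ It) (dW _ It).
  by apply: is_derive_eq; rewrite /GRing.scale/=; ring.
have F'_ge0 t : I t -> 0 <= Q t * (W t - W m) * f t.
  by move=> It; rewrite mulr_ge0 ?QW_ge0 ?f_ge0.
apply: le_trans (ge0_integral_is_derive_le oI iI dF F'_ge0 Ix Iy xy) _.
rewrite (integral_is_derive xy (fun t xyt => dK t (sub t xyt))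
  (fun t xyt => gwC t (sub t xyt))) lee_fin.
have := mulr_ge0 (g_ge0 Iy) (_ : 0 <= W y - W m).
have := mulr_ge0 (g_ge0 Ix) (_ : 0 <= W m - W x).
by rewrite !subr_ge0 !W_nondecr// => /(_ isT) gx /(_ isT) gy; rewrite /F; lra.
Qed.

Variable Q' : R -> R.
Hypothesis Qm : Q m = 0.
Hypothesis dQ : forall x, I x -> is_derive x 1 Q (Q' x).
Hypothesis Q'_gt0 : forall x, I x -> 0 < Q' x.

Lemma sqrB_le_drift_primitive (phi phi' W : R -> R) :
  (forall x, I x -> is_derive x 1 phi (phi' x)) ->
  (forall x, I x -> is_derive x 1 W (phi' x ^+ 2 / Q' x)) ->
  forall x, I x -> (phi x - phi m) ^+ 2 <= Q x * (W x - W m).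
Proof.
move=> dphi dW x Ix; rewrite mulrC -[Q x]subr0 -Qm.
apply: (is_derive_cauchy_schwarz iI dphi dQ dW) => // t It.
by rewrite divfK// lt0r_neq0// Q'_gt0.
Qed.

Hypothesis Q'C : forall x, I x -> {for x, continuous Q'}.
Hypothesis mf : measurable_fun I f.

Lemma weighted_poincare (phi phi' : R -> R) :
  (forall x, I x -> is_derive x 1 phi (phi' x)) ->
  (forall x, I x -> {for x, continuous phi'}) ->
  (\int[mu]_(x in I) ((phi x - phi m) ^+ 2 * f x)%:E <=
   \int[mu]_(x in I) (g x * (phi' x ^+ 2 / Q' x))%:E)%E.
Proof.
move=> dphi phi'C; pose w x := phi' x ^+ 2 / Q' x.
have w_ge0 x : I x -> 0 <= w x.
  by move=> Ix; rewrite divr_ge0 ?sqr_ge0// ltW// Q'_gt0.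
have wC x : I x -> {for x, continuous w}.
  move=> Ix; apply: cvgM; last first.
    by apply: cvgV; [exact/lt0r_neq0/Q'_gt0|exact: Q'C].
  apply: (cvg_comp phi' (fun t => t ^+ 2)); first exact: phi'C.
  exact: exprn_continuous.
have [W dW] := exists_primitive oI iI wC.
have sqr_le := sqrB_le_drift_primitive dphi dW.
have QW_ge0 x : I x -> 0 <= Q x * (W x - W m).
  by move=> Ix; exact: le_trans (sqr_ge0 _) (sqr_le x Ix).
have mI : measurable I by exact: open_measurable.
have m_sqr : measurable_fun I (fun x => (phi x - phi m) ^+ 2 * f x).
  apply: measurable_funM => //; apply: measurable_funX.
  by apply: measurable_funB => //; exact: is_derive_measurable_fun dphi.
have m_drift : measurable_fun I (fun x => Q x * (W x - W m) * f x).
  apply: measurable_funM => //.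
  apply: measurable_funM; first exact: is_derive_measurable_fun dQ.
  by apply: measurable_funB => //; exact: is_derive_measurable_fun dW.
have m_gw : measurable_fun I (fun x => g x * w x).
  apply: measurable_funM; first exact: is_derive_measurable_fun dg.
  exact: continuous_on_open_measurable_fun.
have sqr_f_ge0 x : I x -> 0 <= (phi x - phi m) ^+ 2 * f x.
  by move=> Ix; rewrite mulr_ge0 ?sqr_ge0 ?f_ge0.
apply: (ge0_integral_le_segments oI iI Im) => //; first exact/measurable_EFinP.
move=> x y Ix Iy xmy; have sub := is_interval_subset_itvcc iI Ix Iy.
apply: (@le_trans _ _ (\int[mu]_(t in `[x, y]) (g t * w t)%:E)%E); last first.
  apply: ge0_subset_integral => //; first exact/measurable_EFinP.
  by move=> t It; rewrite lee_fin mulr_ge0 ?g_ge0 ?w_ge0.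
apply: le_trans (integral_drift_primitive_le dW wC w_ge0 QW_ge0 Ix Iy xmy).
apply: ge0_le_integral => //.
- by move=> t /sub; exact: sqr_f_ge0.
- by apply/measurable_EFinP; exact: measurable_funS m_sqr.
- by apply/measurable_EFinP; exact: measurable_funS m_drift.
- by move=> t /sub It; rewrite lee_fin ler_wpM2r ?f_ge0// sqr_le.
Qed.
End stationary_density.

Section open_itv.
Context {R : realType}.
Implicit Types (a b : \bar R) (h : R -> R).

Lemma open_open_itv a b : open (open_itv a b).
Proof. by apply: openI; [exact: open_ereal_gt|exact: open_ereal_lt]. Qed.

Lemma is_interval_open_itv a b : is_interval (open_itv a b).
Proof.
move=> x y [ax _] [_ yb] z /andP[xz zy]; split.
- by apply: lt_le_trans ax _; rewrite lee_fin.
- by apply: le_lt_trans yb; rewrite lee_fin.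
Qed.

#[local] Instance lower_end_proper a : ProperFilter (lower_end a).
Proof. by case: a => [r| |] /=; exact: _. Qed.

#[local] Instance upper_end_proper b : ProperFilter (upper_end b).
Proof. by case: b => [r| |] /=; exact: _. Qed.

Lemma near_lower_end a b :
  (a < b)%E -> \forall x \near lower_end a, open_itv a b x.
Proof.
move=> ab.
suff : \forall x \near lower_end a, (a < x%:E)%E /\ (x%:E < b)%E by [].
case: a b ab => [r| |] [s| |] //= ab; near=> x; split;
  rewrite ?ltry ?ltNyr ?lte_fin//; near: x;
  by [exact: nbhs_right_gt|exact: nbhs_ninfty_lt
    |apply: nbhs_right_lt; rewrite -lte_fin].
Unshelve. all: by end_near.
Qed.

Lemma near_upper_end a b :
  (a < b)%E -> \forall x \near upper_end b, open_itv a b x.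
Proof.
move=> ab.
suff : \forall x \near upper_end b, (a < x%:E)%E /\ (x%:E < b)%E by [].
case: a b ab => [r| |] [s| |] //= ab; near=> x; split;
  rewrite ?ltry ?ltNyr ?lte_fin//; near: x;
  by [exact: nbhs_left_lt|exact: nbhs_pinfty_gt
    |apply: nbhs_left_gt; rewrite -lte_fin].
Unshelve. all: by end_near.
Qed.

Lemma exists_zero_open_itv a b h : (a < b)%E ->
  (forall x, open_itv a b x -> {for x, continuous h}) ->
  (exists2 l : \bar R, (l < 0)%E & (h x)%:E @[x --> lower_end a] --> l) ->
  (exists2 l : \bar R, (0 < l)%E & (h x)%:E @[x --> upper_end b] --> l) ->
  exists2 m, open_itv a b m & h m = 0.
Proof.
move=> ab hC [l l_lt0 hl] [k k_gt0 hk].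
have [x [Ix hx]] : exists x, open_itv a b x /\ ((h x)%:E < 0)%E.
  apply: (@filter_ex _ (lower_end a)).
  apply: filterI; first exact: near_lower_end.
  exact: hl _ (open_ereal_lt' l_lt0).
have [y [Iy hy]] : exists y, open_itv a b y /\ (0 < (h y)%:E)%E.
  apply: (@filter_ex _ (upper_end b)).
  apply: filterI; first exact: near_upper_end.
  exact: hk _ (open_ereal_gt' k_gt0).
rewrite !lte_fin in hx hy.
have h_itv : is_interval (h @` open_itv a b).
  apply/connected_intervalP; apply: connected_continuous_connected.
    by apply/connected_intervalP; exact: is_interval_open_itv.
  by apply: continuous_in_subspaceT => t /set_mem; exact: hC.
have [|m Im hm] := h_itv _ _ (imageP h Ix) (imageP h Iy) 0; last by exists m.
by rewrite (ltW hx) (ltW hy).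
Qed.

Lemma smooth_on_is_derive (I : set R) h x :
  smooth_on I h -> I x -> is_derive x 1 h (derive1 h x).
Proof.
by move=> hS Ix; rewrite derive1E; apply: derivableP; exact: (hS 0%N).
Qed.

Lemma smooth_on_derive1_continuous (I : set R) h x :
  smooth_on I h -> I x -> {for x, continuous (derive1 h)}.
Proof.
move=> hS Ix; apply: differentiable_continuous; apply/derivable1_diffP.
exact: (hS 1%N).
Qed.
End open_itv.

Theorem theorem2p1 (R : realType) (a b : \bar R) (P Q f : R -> R)
  (hab : (a < b)%E)
  (hP : smooth_on (open_itv a b) P)
  (hQ : smooth_on (open_itv a b) Q)
  (hP0 : forall x, open_itv a b x -> 0 <= P x)
  (hQinc : {in open_itv a b &, {homo Q : x y / x < y}})
  (hQ' : forall x, open_itv a b x -> 0 < derive1 Q x)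
  (hQlo : exists2 l : \bar R, (l < 0)%E & (Q x)%:E @[x --> lower_end a] --> l)
  (hQhi : exists2 l : \bar R, (0 < l)%E & (Q x)%:E @[x --> upper_end b] --> l)
  (hfm : measurable_fun (open_itv a b) f)
  (hf0 : forall x, open_itv a b x -> 0 <= f x)
  (hf1 : (\int[lebesgue_measure]_(x in open_itv a b) (f x)%:E = 1)%E)
  (hfeq : forall x, open_itv a b x ->
     derivable (P \* f) x 1 /\ derive1 (P \* f) x + Q x * f x = 0)
  (phi : R -> R)
  (hphi : smooth_on (open_itv a b) phi)
  (hvar : lebesgue_measure.-integrable (open_itv a b)
            (fun x => (phi x ^+ 2 * f x)%:E))
  (hrhs : (\int[lebesgue_measure]_(x in open_itv a b)
            ((P x / derive1 Q x) * (derive1 phi x) ^+ 2 * f x)%:E < +oo)%E) :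
  (\int[lebesgue_measure]_(x in open_itv a b) (phi x ^+ 2 * f x)%:E
   - (\int[lebesgue_measure]_(x in open_itv a b) (phi x * f x)%:E)
     * (\int[lebesgue_measure]_(x in open_itv a b) (phi x * f x)%:E)
   <= \int[lebesgue_measure]_(x in open_itv a b)
        ((P x / derive1 Q x) * (derive1 phi x) ^+ 2 * f x)%:E)%E.
Proof.
have oI : open (open_itv a b) by exact: open_open_itv.
have iI : is_interval (open_itv a b) by exact: is_interval_open_itv.
have dQ x := @smooth_on_is_derive R _ Q x hQ.
have dphi x := @smooth_on_is_derive R _ phi x hphi.
have dPf x : open_itv a b x -> is_derive x 1 (P \* f) (- (Q x * f x)).
  move=> /hfeq[dPfx /eqP]; rewrite addr_eq0 => /eqP <-.
  by rewrite derive1E; exact: derivableP.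
have Pf_ge0 x : open_itv a b x -> 0 <= (P \* f) x.
  by move=> Ix; rewrite mulr_ge0 ?hP0 ?hf0.
have [m Im Qm] := exists_zero_open_itv hab
  (fun x Ix => is_derive_continuous (dQ x Ix)) hQlo hQhi.
apply: (@le_trans _ _ (\int[lebesgue_measure]_(x in open_itv a b)
    ((phi x - phi m) ^+ 2 * f x)%:E)%E).
  apply: variance_le_integral_sqrB => //; first exact: open_measurable.
  exact: is_derive_measurable_fun dphi.
have -> : (\int[lebesgue_measure]_(x in open_itv a b)
      ((P x / derive1 Q x) * (derive1 phi x) ^+ 2 * f x)%:E =
    \int[lebesgue_measure]_(x in open_itv a b)
      ((P \* f) x * (derive1 phi x ^+ 2 / derive1 Q x))%:E)%E.
  by apply: eq_integral => x _; congr EFin; rewrite /=; ring.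
by apply: (weighted_poincare oI iI Im dPf Pf_ge0 hf0 Qm dQ hQ' _ hfm dphi) =>
  x Ix; exact: smooth_on_derive1_continuous Ix.
Qed.
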